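(* Let $(X,d)$ be a compact metric space and $T:X\to X$ a continuous map. Suppose that $T$ has a fixed point and that there exists $N\in\mathbb{N}$ such that for any $x,y\in X$ there exists an integer $0\le i\le N-1$ with $T^i(x)=T^i(y)$. Then $(X,d,T)$ has the almost specification property (that is, it has the almost specification property with mistake function $g$ for some mistake function $g$), and its topological entropy is zero: $h_{top}(T)=0$.
   Context: A dynamical system $(X,d,T)$ is a compact metric space $X$ with metric $d$ together with a continuous map $T:X\to X$. $h_{top}(T)$ denotes its topological entropy (in the usual sense of Bowen). Mistake function: let $\epsilon_0>0$. A function $g:\mathbb{N}\times(0,\epsilon_0]\to\mathbb{N}$ is a mistake function if for all $\epsilon\in(0,\epsilon_0]$ and all $n\in\mathbb{N}$, $g(n,\epsilon)\le g(n+1,\epsilon)$ and $\lim_{n\to\infty} g(n,\epsilon)/n=0$. For $\epsilon\ge\epsilon_0$ one sets $g(n,\epsilon)=g(n,\epsilon_0)$. For $\epsilon>0$ and $n\in\mathbb{N}$ with $g(n,\epsilon)<n$, let $I(g;n,\epsilon)=\{\Lambda\subset\{0,1,\dots,n-1\}:\#\Lambda\ge n-g(n,\epsilon)\}$. For a finite index set $\Lambda\subset\{0,1,\dots,n-1\}$ put $d_\Lambda(x,y)=\max_{j\in\Lambda}d(T^jx,T^jy)$ and $B_\Lambda(x,\epsilon)=\{y\in X: d_\Lambda(x,y)<\epsilon\}$. When $g(n,\epsilon)<n$, define $$B_n(g;x,\epsilon)=\bigcup_{\Lambda\in I(g;n,\epsilon)}B_\Lambda(x,\epsilon).$$ Almost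 specification property with mistake function $g$: there is a function $k_g:(0,\infty)\to\mathbb{N}$, with $g(n,\epsilon)<n$ for all $n\ge k_g(\epsilon)$ (so that the balls below are defined), such that for any $m\ge1$, any $\epsilon_1,\dots,\epsilon_m>0$, any points $x_1,\dots,x_m\in X$ and any integers $n_1\ge k_g(\epsilon_1),\dots,n_m\ge k_g(\epsilon_m)$, there is a point $z\in X$ with $$T^{l_j}(z)\in B_{n_j}(g;x_j,\epsilon_j),\quad j=1,\dots,m,$$ where $n_0=0$ and $l_j=\sum_{s=0}^{j-1}n_s$. *)

(* Defs.v *)
From mathcomp Require Import all_boot all_order all_algebra finmap.
From mathcomp Require Import all_classical all_reals all_analysis.

Set Implicit Arguments.
Unset Strict Implicit.
Unset Printing Implicit Defensive.

Import Order.TTheory GRing.Theory Num.Theory.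
Import numFieldNormedType.Exports.

Local Open Scope classical_set_scope.
Local Open Scope ring_scope.

(* [mf_val n e] is only meaningful for [0 < e <= mf_eps0]; all uses go through
   [mistake] below, which extends it by [mf_val n mf_eps0] for larger [e]. *)
Record mistake_function (R : realType) := MistakeFunction {
  mf_eps0 : R;
  mf_val : nat -> R -> nat;
  mf_eps0_gt0 : 0 < mf_eps0;
  mf_val_mono : forall (e : R) (n : nat), 0 < e <= mf_eps0 ->
    (mf_val n e <= mf_val n.+1 e)%N;
  mf_val_sublinear : forall e : R, 0 < e <= mf_eps0 ->
    (mf_val n e)%:R / n%:R @[n --> \oo] --> (0 : R)
}.

Definition mistake (R : realType) (g : mistake_function R) (n : nat) (e : R) : nat :=
  mf_val g n (Num.min e (mf_eps0 g)).

Section Dynamics.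
Context {R : realType} {X : metricType R}.
Variable T : X -> X.

(* All distances are nonnegative, so taking 0 as the neutral element of the
   maximum only matters for the empty index set. *)
Definition dist_on (n : nat) (L : {set 'I_n}) (x y : X) : R :=
  \big[Num.max/0]_(j in L) mdist (iter j T x) (iter j T y).

Definition ball_on (n : nat) (L : {set 'I_n}) (x : X) (e : R) : set X :=
  [set y | dist_on L x y < e].

Definition mistake_sets (g : mistake_function R) (n : nat) (e : R) :
    set {set 'I_n} :=
  [set L : {set 'I_n} | (n - mistake g n e <= #|L|)%N].
Arguments mistake_sets g n e : clear implicits.

(* Only meaningful when [mistake g n e < n] (the subtraction above truncates);
   [almost_specification_with] imposes this wherever the ball is used. *)
Definition mistake_ball (g : mistake_function R) (n : nat) (x : X) (e : R) :
    set X :=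
  \bigcup_(L in mistake_sets g n e) ball_on L x e.

Definition almost_specification_with (g : mistake_function R) : Prop :=
  exists k : R -> nat,
    (forall (e : R) (n : nat), 0 < e -> (k e <= n)%N -> (mistake g n e < n)%N) /\
    forall (m : nat) (e : 'I_m -> R) (x : 'I_m -> X) (n : 'I_m -> nat),
      (0 < m)%N ->
      (forall j, 0 < e j) ->
      (forall j, (k (e j) <= n j)%N) ->
      exists z : X, forall j : 'I_m,
        mistake_ball g (n j) (x j) (e j)
          (iter (\sum_(s < m | (s < j)%N) n s)%N T z).

Definition almost_specification : Prop :=
  exists g : mistake_function R, almost_specification_with g.

(* On [[set: 'I_n]], [dist_on] is the Bowen metric
   max_{0 <= i < n} d(T^i x, T^i y). *)
Definition bowen_separated (n : nat) (e : R) (E : {fset X}) : Prop :=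
  {in E &, forall x y, x != y -> e < dist_on [set: 'I_n]%SET x y}.

(* Every finite subset of a separated set is separated, so restricting to
   finite sets does not change the supremum. *)
Definition sep_card (n : nat) (e : R) : \bar R :=
  ereal_sup [set (#|` E|%:R)%:E | E in [set E : {fset X} | bowen_separated n e E]].

Definition sep_rate (e : R) : \bar R :=
  limn_esup (fun n : nat => ((n%:R^-1)%:E * lne (sep_card n e))%E).

Definition htop : \bar R := lim (sep_rate e @[e --> 0^'+]).

(* [lim] returns a default value on divergent filters; here the limit always
   exists, by monotonicity. *)
Lemma sep_rate_nonincreasing (e1 e2 : R) :
  e1 <= e2 -> (sep_rate e2 <= sep_rate e1)%E.
Proof.
move=> e12; rewrite /sep_rate !limn_esup_lim.
apply: lee_lim; [exact: is_cvg_esups|exact: is_cvg_esups|].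
apply: nearW => m; apply: ge_ereal_sup => /= _ [n mn <-].
apply: le_ereal_sup_tmp; eexists; first by exists n.
apply: lee_wpmul2l; first by rewrite lee_fin invr_ge0.
have c_ge0 e : (0 <= sep_card n e)%E.
  by apply: ereal_sup_ubound; exists fset0; rewrite ?cardfs0.
rewrite lee_lne ?in_itv/= ?c_ge0 ?leey//.
apply: ereal_sup_le => _ [E sepE <-]; exists E => //= x y xE yE xy.
exact: le_lt_trans e12 (sepE x y xE yE xy).
Qed.

Lemma htop_is_cvg : cvg (sep_rate e @[e --> 0^'+]).
Proof.
apply: nonincreasing_at_right_is_cvge; apply: nearW => e x y _ _.
exact: sep_rate_nonincreasing.
Qed.

End Dynamics.

(* Main.v *)
Require Import Defs.
From mathcomp Require Import all_boot all_order all_algebra finmap.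
From mathcomp Require Import all_classical all_reals all_analysis.
Import Order.TTheory GRing.Theory Num.Theory.
Import numFieldNormedType.Exports.
Local Open Scope classical_set_scope.
Local Open Scope ring_scope.

(** With [p] a fixed point and any two orbits merging within [N] steps, [T^N]
    is constantly equal to [p]. Hence [p] itself traces every finite family of
    orbit segments with at most [N] mistakes on each of them, and the Bowen
    metrics [d_n] are all bounded by [d_N], so that the cardinalities of
    [(n, e)]-separated sets are bounded independently of [n]. *)

Lemma cvg_invn (R : realType) : (n%:R^-1 : R) @[n --> \oo] --> 0.
Proof.
by rewrite -(cvg_shiftS (fun n => n%:R^-1 : R)); exact: cvg_harmonic.
Qed.

(** Comparing [x] with [p] itself: once the orbit of [x] meets that of [p], which never leaves [p],
    it stays there. *)
Lemma iter_merge_const (X : Type) (T : X -> X) (p : X) (N : nat) :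
  T p = p ->
  (forall x y, exists i, (i < N)%N /\ iter i T x = iter i T y) ->
  forall n x, (N <= n)%N -> iter n T x = p.
Proof.
move=> Tp merge n x Nn.
have [i [iN Ti]] := merge x p.
have -> : n = (n - i + i)%N by rewrite subnK// (leq_trans (ltnW iN)).
by rewrite iterD Ti -iterD iter_fix.
Qed.

Lemma continuous_iter (X : topologicalType) (T : X -> X) (n : nat) :
  continuous T -> continuous (iter n T).
Proof.
move=> cT; elim: n => [|n IHn] x /=; first exact: cvg_id.
exact: (@continuous_comp _ _ _ (iter n T) T x (IHn x) (cT _)).
Qed.

Section ConstantMistakes.
Context {R : realType} (N : nat).

Lemma const_mistake_mono (e : R) (n : nat) : 0 < e <= 1 -> (N <= N)%N.
Proof. by []. Qed.

Lemma const_mistake_sublinear (e : R) :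
  0 < e <= 1 -> (N%:R / n%:R : R) @[n --> \oo] --> 0.
Proof. by move=> _; rewrite -(mulr0 N%:R); apply: cvgMr; exact: cvg_invn. Qed.

(** The threshold 1 is arbitrary, since the value [N] is the same at every scale. *)
Definition const_mistake : mistake_function R :=
  @MistakeFunction R 1 (fun _ _ => N) ltr01
    const_mistake_mono const_mistake_sublinear.

End ConstantMistakes.

Section Dynamics.
Context {R : realType} {X : metricType R}.
Variable T : X -> X.

Lemma bowen_totally_bounded (N : nat) (e : R) :
  compact [set: X] -> continuous T -> 0 < e ->
  exists S : {fset X}, forall x, exists2 c, c \in S &
    forall j : 'I_N, mdist (iter j T c) (iter j T x) < e.
Proof.
move=> cX cT e0.
(* [F] encodes 'for all sufficiently large finite sets'. Compactness in near-covering form turns a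
   choice of centre near each point into one finite set of centres. *)
pose F : set_system {fset X} :=
  filter_from setT (fun S0 => [set S | (S0 `<=` S)%fset]).
have FF : Filter F.
  apply: filter_fromT_filter; first by exists fset0.
  move=> S1 S2; exists (S1 `|` S2)%fset => S /= S12S.
  by split; apply: fsubset_trans S12S; [exact: fsubsetUl|exact: fsubsetUr].
pose P (S : {fset X}) x := exists2 c, c \in S &
    forall j : 'I_N, mdist (iter j T c) (iter j T x) < e.
have [|S _ /= SP] := (compact_near_coveringP [set: X]).1 cX _ F P FF.
  move=> c _.
  (* Near [c], the centre [c] itself serves: its Bowen ball is a neighbourhood, as only finitely
     many continuous iterates are involved. *)
  exists ([set x | forall j : 'I_N, mdist (iter j T c) (iter j T x) < e],
          [set S | ([fset c] `<=` S)%fset]) => /=.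
    split; last by exists [fset c]%fset.
    apply: filter_forall => j.
    apply: (metricType_numDomainType.cvgr_dist_lt _ e0).
    exact: continuous_iter.
  by move=> [x S] /= [xc cS]; exists c => //; rewrite -fsub1set.
by exists S => x; exact: SP (fsubset_refl S) x I.
Qed.

(** Pigeonhole: two points sharing a centre at scale [e / 2] are less than [e] apart, so a separated
    set injects into the set of centres. *)
Lemma bowen_separated_bounded (N : nat) (e : R) :
  compact [set: X] -> continuous T -> 0 < e ->
  exists M : nat, forall E : {fset X}, bowen_separated T N e E ->
    (#|` E| <= M)%N.
Proof.
move=> cX cT e0.
have e20 : 0 < e / 2 by rewrite divr_gt0.
have [S SP] := bowen_totally_bounded N _ cX cT e20.
have /choice[f fP] : forall x, exists c, c \in S /\
    forall j : 'I_N, mdist (iter j T c) (iter j T x) < e / 2.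
  by move=> x; have [c cS cx] := SP x; exists c.
exists #|` S| => E sepE.
have finj : {in E &, injective f}.
  move=> x y xE yE fxy; apply/eqP; apply: contraT => xy.
  have := sepE x y xE yE xy; rewrite ltNge => /negP[]; apply/ltW.
  apply: bigmax_lt => // j _.
  apply: (le_lt_trans (metric_triangle _ (iter j T (f x)) _)).
  rewrite [e]splitr ltrD//; last by rewrite fxy; exact: (fP y).2.
  by rewrite metric_sym; exact: (fP x).2.
rewrite -(size_map f).
apply: uniq_leq_size; first by rewrite map_inj_in_uniq// fset_uniq.
by move=> _ /mapP[x _ ->]; exact: (fP x).1.
Qed.

Section Collapsing.
Variables (p : X) (N : nat).
Hypothesis collapse : forall n x, (N <= n)%N -> iter n T x = p.

Lemma dist_on_collapse (n : nat) (x y : X) :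
  dist_on T [set: 'I_n]%SET x y <= dist_on T [set: 'I_N]%SET x y.
Proof.
apply: bigmax_le => [|j _]; first exact: bigmax_ge_id.
have [Nj|jN] := leqP N j.
  by rewrite !collapse// mdistxx bigmax_ge_id.
by apply: (@bigmax_sup _ _ _ _ (Ordinal jN)); rewrite ?inE.
Qed.

Lemma sep_card_ge1 (n : nat) (e : R) : (1 <= sep_card T n e)%E.
Proof.
apply: ereal_sup_ubound; exists [fset p]%fset; last by rewrite cardfs1.
by move=> x y /fset1P-> /fset1P->; rewrite eqxx.
Qed.

Lemma sep_rate_collapse (e : R) :
  compact [set: X] -> continuous T -> 0 < e -> sep_rate T e = 0%E.
Proof.
move=> cX cT e0.
have [M MP] := bowen_separated_bounded N e cX cT e0.
have card_le n : (sep_card T n e <= M%:R%:E)%E.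
  apply: ge_ereal_sup => _ [E sepE <-]; rewrite lee_fin ler_nat.
  apply: MP => x y xE yE xy.
  exact: lt_le_trans (sepE x y xE yE xy) (dist_on_collapse _ _ _).
have M_ge1 : (1 <= M%:R%:E :> \bar R)%E.
  exact: le_trans (sep_card_ge1 0 e) (card_le 0%N).
have M_gt0 : 0 < M%:R :> R by rewrite -lte_fin (lt_le_trans _ M_ge1).
(* The upper limit is computed as a genuine limit, squeezed between 0 and [ln M / n]. *)
apply: (cvg_limn_einf_sup _).2.
apply: (@squeeze_cvge _ _ _ _ (cst 0%E) _ (fun n => (n%:R^-1 * ln M%:R)%:E)).
- apply: nearW => n; rewrite EFinM; apply/andP; split.
    by rewrite mule_ge0 ?lee_fin ?invr_ge0// lne_ge0 sep_card_ge1.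
  rewrite -lne_EFin// lee_wpmul2l ?lee_fin ?invr_ge0//.
  have card_ge0 := le_trans lee01 (sep_card_ge1 n e).
  by rewrite lee_lne ?card_le// in_itv/= leey andbT// (le_trans _ M_ge1).
- exact: cvg_cst.
- apply: cvg_EFin; first exact: nearW.
  by rewrite -(mul0r (ln M%:R)); apply: cvgMl; exact: cvg_invn.
Qed.

Lemma htop_collapse : compact [set: X] -> continuous T -> htop T = 0%E.
Proof.
move=> cX cT; apply: cvg_lim => //; apply: cvg_near_cst.
near=> e; apply: sep_rate_collapse => //; near: e; exact: nbhs_right_gt.
Unshelve. all: by end_near. Qed.

Lemma mistake_ball_collapse (n : nat) (x : X) (e : R) :
  0 < e -> mistake_ball T (const_mistake N) n x e p.
Proof.
(* The mistakes are confined to times before [N]. If [n <= N], this index set is empty and the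
   truncated [n - N] is 0. *)
move=> e0; exists [set j : 'I_n | (N <= j)%N]%SET => /=.
  have /[!card_ord] cardL := cardsC [set j : 'I_n | (N <= j)%N]%SET.
  rewrite /mistake_sets/= /mistake/= leq_subLR -[leqLHS]cardL addnC leq_add2r.
  set A := (~: _)%SET; have -> : #|A| = size (map val (enum A)).
    by rewrite size_map cardE.
  rewrite -(size_iota 0 N); apply: uniq_leq_size.
    by rewrite map_inj_uniq ?enum_uniq//; exact: val_inj.
  by move=> _ /mapP[j + ->]; rewrite mem_enum !inE -ltnNge mem_iota.
apply: bigmax_lt => // j; rewrite inE => Nj.
by rewrite !collapse// mdistxx.
Qed.

Lemma almost_specification_collapse :
  almost_specification_with T (const_mistake N).
Proof.
(* [N.+1] is the least length exceeding the constant number [N] of mistakes. *)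
exists (fun=> N.+1); split => // m e x n _ e0 _; exists p => j.
(* Both [iter N T p] and [iter N.+1 T p] equal [p]. *)
have Tp : T p = p by rewrite -{1}(collapse N p)// -iterS collapse.
by rewrite iter_fix//; exact: mistake_ball_collapse.
Qed.

End Collapsing.
End Dynamics.

Theorem theorem1p1 (R : realType) (X : metricType R) (T : X -> X)
  (compactX : compact [set: X]) (contT : continuous T)
  (fixT : exists p : X, T p = p)
  (mergeT : exists N : nat, forall x y : X,
     exists i : nat, (i < N)%N /\ iter i T x = iter i T y) :
  almost_specification T /\ htop T = 0%E.
Proof.
have [p Tp] := fixT; have [N merge] := mergeT.
have collapse := @iter_merge_const _ _ _ _ Tp merge.
split; last exact: htop_collapse collapse compactX contT.
by exists (const_mistake N); exact: almost_specification_collapse collapse.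
Qed.
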